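(* Let $G$ be a countable group with a minimal non-elementary convergence group action $(\rho,X)$. Then the amenable radical $R_a(G)$ is finite and equal to the kernel $\mathrm{Ker}\,\rho$ of the action. Also $G/R_a(G)$ is a strongly Powers group.
   Context: Convergence group action: Let $G$ be a countable group, $X$ a compact metrizable space and $\rho:G\to \mathrm{Homeo}(X)$ a homomorphism. The pair $(\rho,X)$ is a convergence group action of $G$ if $X$ has at least three points and, for any infinite sequence $\{g_i\}$ of mutually different elements of $G$, there exist a subsequence $\{g_{i_j}\}$ and two (possibly equal) points $r,a\in X$ such that $\rho(g_{i_j})|_{X\setminus\{r\}}$ converges to (the constant map) $a$ uniformly on compact subsets of $X\setminus\{r\}$ and $\rho(g_{i_j}^{-1})|_{X\setminus\{a\}}$ converges to $r$ uniformly on compact subsets of $X\setminus\{a\}$. Such a sequence $\{g_{i_j}\}$ is called a convergence sequence, with repelling point $r$ and attracting point $a$. The limit set $\Lambda(\rho)\subset X$ is the set of all repelling points and attracting points of convergence sequences of $(\rho,X)$. The action is non-elementary if $\Lambda(\rho)$ is infinite. It is minimal if every $\rho(G)$-orbit is dense in $X$. The amenable radical $R_a(G)$ of a group $G$ is its unique maximal amenable normal subgroup. Powers group: A group $G$ is a Powers group if $G\neq\{1\}$ and, for every finite subset $F\subset G\setminus\{1\}$ and every integer $N\ge 1$, there exist a partition $G=C\sqcup D$ and elements $\gamma_1,\dots,\gamma_N\in G$ such that $fC\cap C=\emptyset$ for all $f\in F$ and $\gamma_jD\cap\gamma_kD=\emptyset$ for all $j\neq k$ in $\{1,\dots,N\}$.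 A group is a strongly Powers group if all its non-trivial subnormal subgroups are Powers groups, where a subgroup $N\le G$ is subnormal if there is a finite chain $N=N_k<N_{k-1}<\cdots<N_0=G$ with $N_j$ normal in $N_{j-1}$ for each $j=1,\dots,k$. *)

(* Defs.v *)
From HB Require Import structures.
From mathcomp Require Import all_boot all_order all_algebra generic_quotient.
From mathcomp Require Import all_classical all_reals all_analysis.

Set Implicit Arguments.
Unset Strict Implicit.
Unset Printing Implicit Defensive.

Import Order.TTheory GRing.Theory Num.Theory.
Local Open Scope classical_set_scope.
Local Open Scope ring_scope.
Local Open Scope quotient_scope.

(* Subgroups of a (possibly infinite) group are the library's groupClosed
   boolean predicates; normalClosed are those stable under conjugation. *)
HB.mixin Record isConjClosed (G : groupType) (S : {pred G}) := {
  gpredJ : forall g x : G, x \in S -> (x ^ g)%g \in S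
}.

#[short(type="normalClosed")]
HB.structure Definition NormalClosed (G : groupType) :=
  {S of GroupClosed G S & isConjClosed G S}.

Definition subgrp (G : groupType) (S : groupClosed G) : Type := {x : G | x \in S}.

Section SubgroupType.
Variables (G : groupType) (S : groupClosed G).

Lemma subgrp_closed : group_closed S.
Proof. by split=> [|x y xS yS]; [exact: gpred1 | rewrite gpredM ?gpredVr]. Qed.

HB.instance Definition _ := SubChoice.on (subgrp S).
HB.instance Definition _ :=
  SubChoice_isSubGroup.Build G (mem S) (subgrp S) subgrp_closed.
End SubgroupType.

Section QuotientType.
Variables (G : groupType) (N : normalClosed G).
Implicit Types x y : G.

Definition coset_rel : rel G := fun x y => (x^-1 * y)%g \in N.

Lemma coset_rel_refl : reflexive coset_rel.
Proof. by move=> x; rewrite /coset_rel mulVg gpred1. Qed.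

Lemma coset_rel_imp x y : coset_rel x y -> coset_rel y x.
Proof. by rewrite /coset_rel => /gpredVr; rewrite invgM invgK. Qed.

Lemma coset_rel_sym : symmetric coset_rel.
Proof. by move=> x y; apply/idP/idP => /coset_rel_imp. Qed.

Lemma coset_rel_trans : transitive coset_rel.
Proof.
by move=> y x z xy yz; have := gpredM _ _ xy yz; rewrite mulgA mulgK.
Qed.

Canonical coset_equiv :=
  EquivRel coset_rel coset_rel_refl coset_rel_sym coset_rel_trans.

Definition quotient_group : Type := {eq_quot coset_equiv}.

HB.instance Definition _ := Choice.on quotient_group.
HB.instance Definition _ := EqQuotient.on quotient_group.

Definition quot_pi (x : G) : quotient_group := (\pi x)%qT.
Definition quot_one : quotient_group := quot_pi 1%g.
Definition quot_inv (a : quotient_group) : quotient_group :=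
  quot_pi ((repr a)^-1)%g.
Definition quot_mul (a b : quotient_group) : quotient_group :=
  quot_pi (repr a * repr b)%g.

Lemma quot_piP x y : (quot_pi x = quot_pi y) <-> coset_rel x y.
Proof. by split=> [/eqquotP|h]; [|apply/eqquotP]. Qed.

Lemma quot_piK a : quot_pi (repr a) = a.
Proof. exact: reprK. Qed.

Lemma repr_quot_pi x : coset_rel (repr (quot_pi x)) x.
Proof. by apply/quot_piP; rewrite quot_piK. Qed.

Lemma quot_piV x : quot_inv (quot_pi x) = quot_pi x^-1%g.
Proof.
apply/quot_piP; rewrite /coset_rel invgK.
have := repr_quot_pi x; rewrite coset_rel_sym /coset_rel.
move=> /(gpredJ x^-1%g).
by rewrite /conjg invgK !mulgA mulgV mul1g.
Qed.

Lemma quot_piM x y : quot_mul (quot_pi x) (quot_pi y) = quot_pi (x * y)%g.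
Proof.
apply/quot_piP; rewrite /coset_rel invgM.
set x' := repr (quot_pi x); set y' := repr (quot_pi y).
have hx : (x'^-1 * x)%g \in N := repr_quot_pi x.
have hy : (y'^-1 * y)%g \in N := repr_quot_pi y.
have -> : (y'^-1 * x'^-1 * (x * y) = (x'^-1 * x) ^ y' * (y'^-1 * y))%g.
  by rewrite /conjg !mulgA mulgK.
by apply: gpredM => //; apply: gpredJ.
Qed.

Lemma quot_mulA : associative quot_mul.
Proof.
move=> a b c; rewrite -[a]quot_piK -[b]quot_piK -[c]quot_piK.
by rewrite !quot_piM mulgA.
Qed.
Lemma quot_mul1g : left_id quot_one quot_mul.
Proof. by move=> a; rewrite -[a]quot_piK quot_piM mul1g. Qed.
Lemma quot_mulg1 : right_id quot_one quot_mul.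
Proof. by move=> a; rewrite -[a]quot_piK quot_piM mulg1. Qed.
Lemma quot_mulVg : left_inverse quot_one quot_inv quot_mul.
Proof. by move=> a; rewrite -[a]quot_piK quot_piV quot_piM mulVg. Qed.
Lemma quot_mulgV : right_inverse quot_one quot_inv quot_mul.
Proof. by move=> a; rewrite -[a]quot_piK quot_piV quot_piM mulgV. Qed.

HB.instance Definition _ := isGroup.Build quotient_group
  quot_mulA quot_mul1g quot_mulg1 quot_mulVg quot_mulgV.
End QuotientType.

Section GroupNotions.
Variable G : groupType.

Definition ltranslate (g : G) (A : set G) : set G :=
  [set (g * x)%g | x in A].

(* Amenability of a discrete group: a left-invariant finitely additive
   probability measure defined on all subsets. *)
Definition amenable (R : realType) : Prop :=
  exists mu : set G -> R,
    [/\ forall A, 0 <= mu A,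
        mu setT = 1,
        forall A B, A `&` B = set0 -> mu (A `|` B) = mu A + mu B
      & forall g A, mu (ltranslate g A) = mu A].

Definition powers_group : Prop :=
  (exists g : G, g <> 1%g) /\
  forall F : set G, finite_set F -> F `<=` ~` [set 1%g] ->
  forall N : nat, (1 <= N)%N ->
  exists (C D : set G) (gamma : 'I_N -> G),
    [/\ C `|` D = setT, C `&` D = set0,
        forall f, F f -> ltranslate f C `&` C = set0
      & forall j k : 'I_N, j <> k ->
          ltranslate (gamma j) D `&` ltranslate (gamma k) D = set0].

Definition normal_in (H K : groupClosed G) : Prop :=
  {subset H <= K} /\
  forall g x : G, g \in K -> x \in H -> (x ^ g)%g \in H.

Definition subnormal (N : groupClosed G) : Prop :=
  exists (k : nat) (C : nat -> groupClosed G),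
    [/\ C 0%N =i [pred x : G | true], C k =i N
      & forall j, (j < k)%N -> normal_in (C j.+1) (C j)].

End GroupNotions.

Definition strongly_powers_group (G : groupType) : Prop :=
  forall N : groupClosed G, subnormal N -> (exists2 x : G, x \in N & x <> 1%g) ->
    powers_group (subgrp N).

(* N is the maximum amenable normal subgroup of G; it is then the unique
   maximal one. *)
Definition is_amenable_radical (R : realType) (G : groupType)
    (N : normalClosed G) : Prop :=
  amenable (subgrp N) R /\
  forall M : normalClosed G, amenable (subgrp M) R -> {subset M <= N}.

Definition homeomorphism (T U : topologicalType) (f : T -> U) : Prop :=
  exists g : U -> T,
    [/\ cancel f g, cancel g f, continuous f & continuous g].

Section ConvergenceActions.
Variables (R : realType) (G : groupType) (X : metricType R).
Variable rho : G -> X -> X.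

Definition action_by_homeo : Prop :=
  (forall g, homeomorphism (rho g)) /\
  (forall g h, rho (g * h)%g = rho g \o rho h).

Definition cvg_to_cst_off (u : nat -> X -> X) (r a : X) : Prop :=
  forall K : set X, compact K -> K `<=` ~` [set r] ->
    {uniform K, u @ \oo --> (fun _ : X => a)}.

Definition convergence_sequence (g : nat -> G) (r a : X) : Prop :=
  [/\ injective g,
      cvg_to_cst_off (fun i => rho (g i)) r a
    & cvg_to_cst_off (fun i => rho (g i)^-1%g) a r].

Definition convergence_action : Prop :=
  [/\ action_by_homeo,
      exists x y z : X, [/\ x <> y, y <> z & x <> z]
    & forall g : nat -> G, injective g ->
        exists (phi : nat -> nat) (r a : X),
          {homo phi : m n / (m < n)%N} /\ convergence_sequence (g \o phi) r a].

Definition limit_set : set X :=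
  [set x | exists (g : nat -> G) (r a : X),
    convergence_sequence g r a /\ (x = r \/ x = a)].

Definition non_elementary : Prop := infinite_set limit_set.

Definition minimal_action : Prop :=
  forall x : X, dense [set rho g x | g in [set: G]].

Definition action_kernel : set G := [set g | rho g = id].

End ConvergenceActions.

(* Main.v *)
Require Import Defs.
From HB Require Import structures.
From mathcomp Require Import all_boot all_order all_algebra.
From mathcomp Require Import all_classical all_reals all_analysis.
From mathcomp Require Import lra.

(* Translating a convergence sequence by group elements moves its repelling and
   attracting points into prescribed open sets, so by minimality the action is
   extremely proximal: for nonempty open [U] and [V] some [g] sends the
   complement of [U] into [V]. This passes to every subnormal subgroup [N] acting
   nontrivially. The convergence property forbids an element outside the kernel
   from fixing a nonempty open set, so a finite set of such elements displaces a
   common open set [U]; the elements of [N] sending a base point into [U], and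
   their complement, form a Powers partition. Such a partition excludes an
   invariant mean, so amenable normal subgroups lie in the kernel, which is
   finite because a convergence sequence cannot consist of identity maps. *)

Set Implicit Arguments.
Unset Strict Implicit.
Unset Printing Implicit Defensive.

Import Order.TTheory GRing.Theory Num.Theory.
Local Open Scope classical_set_scope.

(** * Invariant means: finite groups, and the obstruction given by a Powers partition *)

Section Amenability.
Variables (R : realType) (G : groupType).
Local Open Scope ring_scope.

(** Normalized counting measure is an invariant mean: left translation only permutes a
    duplicate-free enumeration of the group. *)
Lemma finite_amenable : finite_set [set: G] -> amenable G R.
Proof.
move=> /finite_seqP[s0 s0T]; pose s := undup s0.
have sT x : x \in s.
  by rewrite mem_undup; have : [set: G] x by []; rewrite s0T.
have us : uniq s by exact: undup_uniq.
have s_gt0 : (0 < size s)%N by case: (s) (sT 1%g).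
exists (fun A => (count (fun x => `[< A x >]) s)%:R / (size s)%:R); split.
- by move=> A; rewrite divr_ge0.
- rewrite (eq_count (a2 := predT)) ?count_predT; last by move=> x; apply/asboolP.
  by rewrite divff// pnatr_eq0 -lt0n.
- move=> A B AB0; rewrite -mulrDl -natrD -count_predUI; congr (_%:R / _).
  rewrite [X in (_ + X)%N](eq_count (a2 := pred0)) ?count_pred0 ?addn0.
    by apply: eq_count => x /=; rewrite asbool_or.
  move=> x /=; apply/negP => /andP[/asboolP Ax /asboolP Bx].
  by have : (A `&` B) x by []; rewrite AB0.
- move=> g A; congr (_%:R / _).
  have sg : perm_eq s [seq (g * x)%g | x <- s].
    apply: uniq_perm => //; first by rewrite map_inj_uniq //; exact: mulgI.
    move=> x; rewrite sT; apply/esym/mapP; exists (g^-1 * x)%g => //.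
    by rewrite mulVKg.
  rewrite (permP sg) count_map; apply: eq_count => x /=.
  apply/asboolP/asboolP => [[y Ay /mulgI <-//]|Ax]; by exists x.
Qed.

(* [C] has measure at most 1/2 and [D] at most 1/3, yet they cover the group. *)
Lemma powers_partition_not_amenable (C D : set G) (f : G) (gamma : 'I_3 -> G) :
  C `|` D = setT -> C `&` D = set0 -> ltranslate f C `&` C = set0 ->
  (forall j k, j <> k ->
    ltranslate (gamma j) D `&` ltranslate (gamma k) D = set0) ->
  ~ amenable G R.
Proof.
move=> CDT CD0 fC gD [mu [mu_ge0 muT muU muM]].
have mu_le1 A : mu A <= 1.
  by rewrite -muT -(setUCr A) muU ?setICr// lerDl.
have CD1 : mu C + mu D = 1 by rewrite -muU// CDT.
have C2 : mu C + mu C <= 1.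
  by rewrite -[X in X + _ <= _](muM f) -muU.
have D3 : mu D + mu D + mu D <= 1.
  rewrite -[X in X + _ + _ <= _](muM (gamma ord0)).
  rewrite -[X in _ + X + _ <= _](muM (gamma (inord 1))).
  rewrite -[X in _ + X <= _](muM (gamma (inord 2))).
  rewrite -muU ?gD -?muU//.
  - by rewrite setIUl !gD ?setU0// => /(congr1 val); rewrite /= !inordK.
  - by move=> /(congr1 val); rewrite /= !inordK.
move: {CDT CD0 fC gD muU muT mu_ge0 mu_le1 muM} (mu C) (mu D) CD1 C2 D3 => c d.
lra.
Qed.

End Amenability.

(** Serves as the ambient term of [normal_in] when a normal subgroup of [G] is treated. *)
Definition full_subgroup (G : groupType) : groupClosed G :=
  HB.pack_for (groupClosed G) ([pred x : G | true] : {pred G})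
    (isMulClosed.Build G [pred x : G | true] (fun _ _ _ _ => isT))
    (isMul1Closed.Build G [pred x : G | true] isT)
    (isInvClosed.Build G [pred x : G | true] (fun _ _ => isT)).

Lemma infinite_injective_seq (T : Type) (A : set T) : infinite_set A ->
  exists2 s : nat -> T, injective s & forall n, A (s n).
Proof.
move=> /infiniteP/card_leP[f]; exists (fun n => val (f (to_setT n))).
  by move=> m n /val_inj /'inj_f; rewrite !inE => /(_ I I)/(congr1 val).
by move=> n; exact: set_valP.
Qed.

(** * Disjoint open sets in Hausdorff spaces without isolated points *)

Definition no_isolated_points (X : topologicalType) : Prop :=
  forall U : set X, open U -> U !=set0 -> exists x y, [/\ U x, U y & x <> y].

Section DisjointOpens.
Variable X : topologicalType.
Hypothesis hausdorffX : hausdorff_space X.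

Lemma separate_opens (x y : X) : x <> y ->
  exists A B : set X, [/\ open A, open B, A x, B y & A `&` B = set0].
Proof.
move: hausdorffX; rewrite open_hausdorff => sepX /eqP /sepX.
move=> [[A B] /= [/set_mem Ax /set_mem By] [oA oB /eqP AB0]].
by exists A, B.
Qed.

Hypothesis perfectX : no_isolated_points X.

Lemma split_open (U : set X) : open U -> U !=set0 ->
  exists A B : set X, [/\ open A /\ A !=set0, open B /\ B !=set0,
    A `<=` U, B `<=` U & A `&` B = set0].
Proof.
move=> oU U0; have [x [y [Ux Uy xy]]] := perfectX oU U0.
have [A [B [oA oB Ax By AB0]]] := separate_opens xy.
exists (A `&` U), (B `&` U); split.
- by split; [exact: openI | exists x].
- by split; [exact: openI | exists y].
- by move=> z [].
- by move=> z [].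
- by rewrite setIACA AB0 set0I.
Qed.

(** Split the space into two disjoint open pieces, keep the first as [V 0], split the second again,
    and so on; [W n] below is the piece still to be split. *)
Lemma disjoint_opens (x0 : X) : exists V : nat -> set X,
  (forall n, open (V n) /\ V n !=set0) /\
  (forall m n x, V m x -> V n x -> m = n).
Proof.
pose P (U : set X) := open U /\ U !=set0.
(* Choice needs a total function, so sets that are not nonempty and open get a dummy pair. *)
have /choice[f fP] (U : set X) : exists AB : set X * set X, P U ->
    [/\ P AB.1, P AB.2, AB.1 `<=` U, AB.2 `<=` U & AB.1 `&` AB.2 = set0].
  have [[oU U0]|nU] := pselect (P U); last by exists (set0, set0).
  by have [A [B]] := split_open oU U0; exists (A, B).
pose W n := iter n (fun U => (f U).2) setT.
have PW n : P (W n).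
  elim: n => [|n /fP[]//]; split; [exact: openT | by exists x0].
have subW k n : (W (k + n)%N `<=` W n).
  elim: k => // k IH; apply: subset_trans IH; by have [] := fP _ (PW (k + n)%N).
exists (fun n => (f (W n)).1); split=> [n|]; first by have [] := fP _ (PW n).
have ltV m n x : (m < n)%N -> (f (W m)).1 x -> ~ (f (W n)).1 x.
  move=> mn Vm Vn; have [_ _ _ _ disj] := fP _ (PW m).
  suff : ((f (W m)).1 `&` (f (W m)).2) x by rewrite disj.
  split=> //; apply: (subW (n - m.+1)%N m.+1); rewrite subnK//.
  by have [_ _ + _ _] := fP _ (PW n); exact.
move=> m n x Vm Vn; case: (ltngtP m n) => // mn.
- by have := ltV _ _ _ mn Vm.
- by have := ltV _ _ _ mn Vn.
Qed.

End DisjointOpens.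

(** * Extremely proximal actions and their Powers partitions *)

Section ExtremelyProximalActions.
Variables (X : topologicalType) (G : groupType) (act : G -> X -> X).

Definition extremely_proximal (H : {pred G}) : Prop :=
  forall U V : set X, open U -> U !=set0 -> open V -> V !=set0 ->
  exists2 g, g \in H & forall x, ~ U x -> V (act g x).

Definition topologically_free (g : G) : Prop :=
  forall U : set X, open U -> U !=set0 -> exists2 x, U x & act g x <> x.

Hypothesis hausdorffX : hausdorff_space X.
Hypothesis perfectX : no_isolated_points X.
Hypothesis act1 : act 1%g = id.
Hypothesis actM : forall g h, act (g * h)%g = act g \o act h.
Hypothesis act_continuous : forall g, continuous (act g).

Lemma actK g : cancel (act g) (act g^-1%g).
Proof. by move=> x; rewrite -[LHS]/((act _ \o act _) x) -actM mulVg act1. Qed.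

Lemma actVK g : cancel (act g^-1%g) (act g).
Proof. by move=> x; rewrite -[LHS]/((act _ \o act _) x) -actM mulgV act1. Qed.

Lemma displaced_open (g : G) (U : set X) (x : X) :
  open U -> U x -> act g x <> x ->
  exists W : set X, [/\ open W, W x, W `<=` U & forall y, W y -> ~ W (act g y)].
Proof.
move=> oU Ux gx; have [A [B [oA oB Agx Bx AB0]]] := separate_opens hausdorffX gx.
exists (U `&` (B `&` act g @^-1` A)); split=> //.
- apply: openI => //; apply: openI => //.
  by apply: open_comp oA => y _; exact: act_continuous.
- move=> y [_ [_ Agy]] [_ [Bgy _]].
  by have : (A `&` B) (act g y) by []; rewrite AB0.
Qed.

(** Shrink [U] for one element at a time: an open set displaced by [g] stays displaced after further
    shrinking. *)
Lemma displaced_open_seq (s : seq G) (U : set X) :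
  (forall g, g \in s -> topologically_free g) -> open U -> U !=set0 ->
  exists W : set X, [/\ open W, W !=set0, W `<=` U &
    forall g y, g \in s -> W y -> ~ W (act g y)].
Proof.
elim: s U => [|g s IH] U sfree oU U0; first by exists U; split.
have [x Ux gx] := sfree g (mem_head _ _) U oU U0.
have [W [oW Wx WU gW]] := displaced_open oU Ux gx.
have [||W' [oW' W'0 W'W sW']] := IH W _ oW; last 1 first.
- exists W'; split=> //; first exact: subset_trans WU.
  move=> h y; rewrite inE => /predU1P[-> W'y W'gy|hs]; last exact: sW'.
  by apply: (gW y); exact: W'W.
- by move=> h hs; apply: sfree; rewrite inE hs orbT.
- by exists x.
Qed.

(* If [f W] misses [W] and [h] in [K] sends the complement of [W] into [V], then
   [h f h^-1] sends the complement of [V] into [V]; one such element for [U]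
   followed by one for a disjoint [V] sends the complement of [U] into [V]. *)
Lemma extremely_proximal_normal (H K : groupClosed G) :
  normal_in H K -> extremely_proximal K ->
  (exists2 f, f \in H & exists x, act f x <> x) -> extremely_proximal H.
Proof.
move=> [HK nHK] pK [f fH [x fx]].
have [W [oW Wx _ fW]] := displaced_open openT (I : setT x) fx.
have into V : open V -> V !=set0 ->
    exists2 g, g \in H & forall y, ~ V y -> V (act g y).
  move=> oV V0; have [|h hK hV] := pK W V oW _ oV V0; first by exists x.
  exists (f ^ h^-1)%g; first by apply: nHK => //; rewrite gpredV.
  move=> y nVy; rewrite /conjg invgK !actM /=; apply: (hV) => Wfy.
  have [Wy|nWy] := pselect (W (act h^-1%g y)); first exact: fW Wfy.
  by apply: nVy; rewrite -(actVK h y); exact: hV.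
move=> U V oU U0 oV V0.
suff [A [B [[oA A0] [oB B0] AU BV AB0]]] : exists A B : set X,
    [/\ open A /\ A !=set0, open B /\ B !=set0,
      A `<=` U, B `<=` V & A `&` B = set0].
  have [a aH aA] := into A oA A0; have [b bH bB] := into B oB B0.
  exists (b * a)%g => [|y nUy]; first exact: gpredM.
  rewrite actM /=; apply/BV/bB => Bay.
  suff : (A `&` B) (act a y) by rewrite AB0.
  by split=> //; apply: aA => /AU.
(* If [U] and [V] meet, two disjoint open pieces of their intersection replace them; this is where
   the absence of isolated points enters. *)
have [UV0|/set0P UV] := eqVneq (U `&` V) set0; first by exists U, V; split.
have [A [B [A0 B0 AU BU AB0]]] := split_open hausdorffX perfectX (openI oU oV) UV.
by exists A, B; split=> // y; [move=> /AU[] | move=> /BU[]].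
Qed.

(** Descend the chain with the normal case; its nontriviality condition holds at every link because
    [f] lies in [N], hence in each [C j]. *)
Lemma extremely_proximal_subnormal (N : groupClosed G) :
  extremely_proximal [pred x : G | true] -> subnormal N ->
  (exists2 f, f \in N & exists x, act f x <> x) -> extremely_proximal N.
Proof.
move=> pG [k [C [C0 Ck nC]]] [f fN fx].
have fC j : (j <= k)%N -> f \in C (k - j)%N.
  elim: j => [|j IH] jk; first by rewrite subn0 Ck.
  have [sub _] := nC (k - j.+1)%N (ltac:(by rewrite ltn_subrL (leq_trans _ jk))).
  by apply: sub; rewrite -subSn// subSS; apply: IH; exact: ltnW.
have pC j : (j <= k)%N -> extremely_proximal (C j).
  elim: j => [_|j IH jk].
    by move=> U V oU U0 oV V0; have [g _ gP] := pG U V oU U0 oV V0;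
       exists g; rewrite ?C0.
  apply: extremely_proximal_normal (nC _ jk) (IH (ltnW jk)) _.
  by exists f => //; rewrite -(subKn jk); apply: fC; exact: leq_subr.
move=> U V oU U0 oV V0; have [g gC gP] := pC k (leqnn k) U V oU U0 oV V0.
by exists g; rewrite -?Ck.
Qed.

(* The partition is read off an orbit: [C] consists of the elements sending a
   base point into an open set displaced by every element of [F]. *)
Lemma powers_partition (H : groupClosed G) (x0 : X) (F : set (subgrp H))
    (N : nat) :
  extremely_proximal H -> finite_set F ->
  (forall f, F f -> topologically_free (val f)) ->
  exists (C D : set (subgrp H)) (gamma : 'I_N -> subgrp H),
    [/\ C `|` D = setT, C `&` D = set0,
        forall f, F f -> ltranslate f C `&` C = set0
      & forall j k : 'I_N, j <> k ->
          ltranslate (gamma j) D `&` ltranslate (gamma k) D = set0].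
Proof.
move=> pH /finite_seqP[s Fs] Ffree.
have [||U [oU U0 _ sU]] := @displaced_open_seq [seq val f | f <- s] setT _ openT.
- by move=> g /mapP[f fs ->]; apply: Ffree; rewrite Fs.
- by exists x0.
have [V [V0 Vdisj]] := disjoint_opens hausdorffX perfectX x0.
(* Elements of [D] send the base point outside [U], so those of [gamma j D] send it into [V j], and
   the [V j] are disjoint. *)
have /choice[gamma gammaP] (j : 'I_N) :
    exists g : subgrp H, forall x, ~ U x -> V j (act (val g) x).
  have [oVj Vj0] := V0 j; have [g gH gV] := pH U (V j) oU U0 oVj Vj0.
  by exists (Sub g gH); rewrite SubK.
have valM (g h : subgrp H) : val (g * h)%g = (val g * val h)%g by [].
exists [set g | U (act (val g) x0)], [set g | ~ U (act (val g) x0)], gamma.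
split.
- by apply/seteqP; split=> // g _; exact: EM.
- by apply/seteqP; split=> // g [].
- move=> f Ff; apply/seteqP; split=> // _ [[g /= Ug <-]].
  rewrite /mkset valM actM; apply: sU => //.
  by apply: map_f; move: Ff; rewrite Fs.
- move=> j k jk; apply/seteqP; split=> // _ [[g /= nUg <-] [h /= nUh hg]].
  apply: jk; apply/val_inj/(Vdisj _ _ (act (val (gamma j * g)%g) x0)).
  + by rewrite valM actM; exact: gammaP.
  + by rewrite -hg valM actM; exact: gammaP.
Qed.

End ExtremelyProximalActions.

(** * Convergence actions and their kernel *)

Section ConvergenceActionTheory.
Variables (R : realType) (G : groupType) (X : metricType R).
Variable rho : G -> X -> X.
Local Open Scope group_scope.

Hypothesis actX : action_by_homeo rho.

Lemma action_by_homeo1 : rho 1 = id.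
Proof.
have [[f [fK _ _ _]] rhoM] := (actX.1 1, actX.2).
apply/funext => x; apply: (can_inj fK).
by rewrite -[LHS]/((rho 1 \o rho 1) x) -rhoM mulg1.
Qed.

Lemma action_by_homeo_continuous g : continuous (rho g).
Proof. by have [f []] := actX.1 g. Qed.

Definition kernel_pred : {pred G} := [pred g | `[< rho g = id >]].

Lemma kernel_predP g : g \in kernel_pred <-> rho g = id.
Proof. by split=> [/asboolP|?]; [|apply/asboolP]. Qed.

Fact kernel_predM : mulg_closed kernel_pred.
Proof.
move=> g h /kernel_predP gK /kernel_predP hK.
by apply/kernel_predP; rewrite actX.2 gK hK.
Qed.

Fact kernel_pred1 : 1 \in kernel_pred.
Proof. by apply/kernel_predP; exact: action_by_homeo1. Qed.

Fact kernel_predV : invg_closed kernel_pred.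
Proof.
move=> g /kernel_predP gK; apply/kernel_predP.
by have := actX.2 g^-1 g; rewrite mulVg action_by_homeo1 gK => /esym.
Qed.

Fact kernel_predJ g x : x \in kernel_pred -> x ^ g \in kernel_pred.
Proof.
move=> /kernel_predP xK; apply/kernel_predP.
rewrite /conjg !actX.2 xK; transitivity (rho (g^-1 * g)); first by rewrite actX.2.
by rewrite mulVg action_by_homeo1.
Qed.

Definition kernel : normalClosed G := HB.pack_for (normalClosed G) kernel_pred
  (isMulClosed.Build G kernel_pred kernel_predM)
  (isMul1Closed.Build G kernel_pred kernel_pred1)
  (isInvClosed.Build G kernel_pred kernel_predV)
  (isConjClosed.Build G kernel_pred kernel_predJ).

Lemma kernelP g : g \in kernel <-> rho g = id.
Proof. exact: kernel_predP. Qed.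

Let hausdorffX : hausdorff_space X := @metric_hausdorff R X.

Lemma cvg_to_cst_off_pt (u : nat -> X -> X) (r a x : X) :
  cvg_to_cst_off u r a -> x <> r -> u n x @[n --> \oo] --> a.
Proof.
move=> ua xr; have := ua [set x] (@compact_set1 _ x); rewrite uniform_set1.
by apply=> _ ->.
Qed.

Hypothesis compactX : compact [set: X].

(** The complement of [U] is compact and avoids [r], so the convergence to [a] is uniform on it. *)
Lemma cvg_to_cst_off_open (u : nat -> X -> X) (r a : X) (U V : set X) :
  cvg_to_cst_off u r a -> open U -> U r -> open V -> V a ->
  exists n, forall x, ~ U x -> V (u n x).
Proof.
move=> ua oU Ur oV Va.
have cU : compact (~` U).
  by apply: subclosed_compact compactX _ => //; exact: open_closedC.
have Ur' : ~` U `<=` ~` [set r] by move=> x nUx xr; apply: nUx; rewrite xr.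
have := ua _ cU Ur' [set h | forall x, ~ U x -> V (h x)].
have : nbhs a V by exact: open_nbhs_nbhs.
rewrite -nbhs_entourageE => -[E entE EV] /(_ _)[].
  apply/uniform_nbhs; exists E; split=> // h Eh x nUx.
  by apply/EV/xsectionP/Eh.
by move=> N _ NP; exists N; exact: NP (leqnn N).
Qed.

Hypothesis convX : convergence_action rho.

(** Along a convergence subsequence every point other than [r] tends to [a]; if it is also
    eventually fixed it equals [a], leaving at most two points in [X]. Both finiteness of the kernel
    and topological freeness rest on this. *)
Lemma convergence_action_not_eventually_fixed (g : nat -> G) : injective g ->
  ~ (forall x, \forall n \near \oo, rho (g n) x = x).
Proof.
move=> g_inj gfix.
have [_ [x [y [z [xy yz xz]]]] conv] := convX.
have [phi [r [a [phi_lt [_ ga _]]]]] := conv g g_inj.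
have phi_ge n : (n <= phi n)%N.
  by elim: n => // n IH; exact: leq_ltn_trans (phi_lt _ _ (ltnSn n)).
have phi_cvg : phi @ \oo --> \oo.
  apply/cvgnyPge => A; near=> n; apply: leq_trans (phi_ge n).
  by near: n; exact: nbhs_infty_ge.
have ra p : p <> r -> p = a.
  move=> pr; have ga_p := cvg_to_cst_off_pt ga pr.
  apply/esym/(cvg_unique hausdorffX ga_p) => /=.
  apply: cvg_near_cst => /=; exact: phi_cvg (gfix p).
have [xr|/ra xa] := pselect (x = r).
  have ya : y = a by apply: ra; rewrite -xr => /esym.
  have za : z = a by apply: ra; rewrite -xr => /esym.
  by apply: yz; rewrite ya za.
have [yr|/ra ya] := pselect (y = r); last by apply: xy; rewrite xa ya.
have za : z = a by apply: ra; rewrite -yr => /esym.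
by apply: xz; rewrite xa za.
Unshelve. all: by end_near. Qed.

Lemma kernel_finite : finite_set [set` kernel].
Proof.
apply: contrapT => /infinite_injective_seq[g g_inj gK].
apply: (convergence_action_not_eventually_fixed g_inj) => x.
by apply: nearW => n; have /kernelP -> := gK n.
Qed.

(** * Consequences of minimality and of an infinite limit set *)

Hypothesis minX : minimal_action rho.
Hypothesis nonelemX : non_elementary rho.

(** Every orbit meets an isolated point, so one isolated point makes [X] discrete; a discrete
    compact space cannot contain an infinite limit set. *)
Lemma minimal_no_isolated_points : no_isolated_points X.
Proof.
move=> U oU [x Ux]; apply: contrapT => noxy.
have Ux1 y : U y -> y = x.
  by move=> Uy; apply: contrapT => yx; apply: noxy; exists y, x.
have open1 y : exists2 W : set X, open W & W = [set y].
  have [_ [/[swap] [[g _ <-]] Ugy]] := minX y (ex_intro _ x Ux) oU.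
  exists (rho g @^-1` U).
    by apply: open_comp oU => z _; exact: action_by_homeo_continuous.
  apply/seteqP; split=> [z /= Ugz|_ -> //].
  have [f [fK _ _ _]] := actX.1 g; apply: (can_inj fK).
  by rewrite (Ux1 _ Ugz) (Ux1 _ Ugy).
have [s s_inj _] := infinite_injective_seq nonelemX.
(* A cluster point [p] of the injective sequence [s] is isolated, so [s] takes the value [p] at two
   different indices. *)
have [|p [_ sp]] := @compactX (s @ \oo) _; first exact: filterT.
have [W oW W1] := open1 p.
have pW : nbhs p [set p] by rewrite -W1; apply: open_nbhs_nbhs; split=> //; rewrite W1.
have sp_ge N : exists2 n, (N <= n)%N & s n = p.
  have [|_ [[n Nn <-] snp]] := sp (s @` [set n | (N <= n)%N]) _ _ pW.
    by exists N => // n Nn; exists n.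
  by exists n.
have [n _ sn] := sp_ge 0%N; have [m nm sm] := sp_ge n.+1.
have mn : m = n by apply: s_inj; rewrite sn sm.
by move: nm; rewrite mn ltnn.
Qed.

Lemma convergence_extremely_proximal :
  extremely_proximal rho [pred x : G | true].
Proof.
move=> U V oU U0 oV V0; have [_ [g [r [a [[_ ga _] _]]]]] := infinite_setN0 nonelemX.
(* [k] carries [r] into [U] and [h] carries [a] into [V], so a late [g n] sends the complement of
   the preimage of [U] under [k] into the preimage of [V] under [h]. *)
have [r1 [Ur1 [k _ kr]]] := minX r U0 oU.
have [a1 [Va1 [h _ ha]]] := minX a V0 oV.
have rhoK l : cancel (rho l) (rho l^-1).
  exact: actK (action_by_homeo1) actX.2 l.
have preimage_open l W : open W -> open (rho l @^-1` W).
  by move=> oW; apply: open_comp oW => z _; exact: action_by_homeo_continuous.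
have [n nP] := cvg_to_cst_off_open ga (preimage_open k _ oU) (ltac:(by rewrite /= kr))
  (preimage_open h _ oV) (ltac:(by rewrite /= ha)).
exists (h * (g n * k^-1)) => // x nUx; rewrite !actX.2; apply: nP => /=.
by rewrite -[X in rho X (rho k^-1 x)](invgK k) rhoK.
Qed.

(* If [f] fixes an open set pointwise, extreme proximality conjugates it to
   elements [F n] supported in disjoint open sets [V n]; every point is then
   fixed by all but at most one [F n]. *)
Lemma convergence_topologically_free f :
  rho f <> id -> topologically_free rho f.
Proof.
move=> fN1 U oU U0; apply: contrapT => nfU.
have fU x : U x -> rho f x = x.
  by move=> Ux; apply: contrapT => fx; apply: nfU; exists x.
have [x0 _] := U0; have [r0 r1] := (action_by_homeo1, actX.2).
have [V [V0 Vdisj]] := disjoint_opens hausdorffX minimal_no_isolated_points x0.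
have /choice[g gV] n : exists g, forall x, ~ U x -> V n (rho g x).
  have [oVn Vn0] := V0 n.
  by have [g _ gV] := convergence_extremely_proximal oU U0 oVn Vn0; exists g.
pose F n := g n * (f * (g n)^-1).
have Ffix n x : ~ V n x -> rho (F n) x = x.
  move=> nVx; rewrite !actX.2 /= fU ?(actVK r0 r1)//.
  by apply: contrapT => /(gV n); rewrite (actVK r0 r1).
have FN1 n : ~ (forall x, rho (F n) x = x).
  move=> Fid; apply: fN1; apply/funext => x.
  rewrite -[RHS](actK r0 r1 (g n)) -[in RHS](Fid (rho (g n) x)) !actX.2 /=.
  by rewrite !(actK r0 r1).
(* If [F m = F n] with [m <> n], this element moves points only inside [V m] and [V n] at once, so
   it acts trivially, against [FN1]. *)
have F_inj : injective F.
  move=> m n Fmn; apply: contrapT => mn; apply: (FN1 m) => x.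
  have [Vmx|/Ffix//] := pselect (V m x); rewrite Fmn; apply: Ffix => Vnx.
  by apply: mn; exact: Vdisj Vmx Vnx.
apply: (convergence_action_not_eventually_fixed F_inj) => x.
have [[m Vmx]|nV] := pselect (exists m, V m x); last first.
  by apply: nearW => n; apply: Ffix => Vnx; apply: nV; exists n.
near=> n; apply: Ffix => Vnx; have mn := Vdisj _ _ _ Vmx Vnx.
suff : (m < n)%N by rewrite mn ltnn.
by near: n; exact: nbhs_infty_gt.
Unshelve. all: by end_near. Qed.

Lemma amenable_normal_sub_kernel (M : normalClosed G) :
  amenable (subgrp M) R -> {subset M <= kernel}.
Proof.
move=> amM f fM; apply/kernelP; apply: contrapT => fN1.
have [r0 r1] := (action_by_homeo1, actX.2).
have cr := action_by_homeo_continuous.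
have perfX := minimal_no_isolated_points.
have [x fx] : exists x, rho f x <> x.
  apply: contrapT => nfx; apply/fN1/funext => x.
  by apply: contrapT => fx; apply: nfx; exists x.
have pM : extremely_proximal rho M.
  apply: (extremely_proximal_normal hausdorffX perfX r0 r1 cr (K := full_subgroup G)).
  - by split=> // g y _; exact: Defs.gpredJ.
  - exact: convergence_extremely_proximal.
  - by exists f => //; exists x.
pose f' : subgrp M := Sub f fM.
(* One displaced element and three translates suffice, since 1/2 + 1/3 < 1. *)
have [_ ->|C [D [gamma [CD CD0 fC gD]]]] := powers_partition hausdorffX
  perfX r1 cr x 3 pM (finite_set1 f').
  by rewrite SubK; exact: convergence_topologically_free.
exact: powers_partition_not_amenable CD CD0 (fC f' erefl) gD amM.
Qed.

(** The quotient acts through coset representatives. This action is faithful, so every nontrivial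
    class is topologically free and any finite [F] avoiding 1 is admissible in
    [powers_partition]. *)
Lemma quotient_kernel_strongly_powers :
  strongly_powers_group (quotient_group kernel).
Proof.
pose Q := quotient_group kernel.
pose act (q : Q) := rho (repr q).
have [r0 r1] := (action_by_homeo1, actX.2).
(* The representative of the class of [g] differs from [g] by a kernel element, which acts
   trivially. *)
have actE g : act (quot_pi _ g) = rho g.
  have /kernelP := repr_quot_pi kernel g; rewrite r1 => kg.
  apply/funext => x; rewrite /act -[in LHS](congr1 (@^~ x) kg) /=.
  by rewrite (actVK r0 r1).
have act1 : act 1%g = id by rewrite -r0 -actE.
have actM (p q : Q) : act (p * q)%g = act p \o act q.
  by rewrite -[p]quot_piK -[q]quot_piK [X in act X]quot_piM !actE r1.
have act_cont q : continuous (act q) by exact: action_by_homeo_continuous.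
have act_faithful q : q <> 1%g -> act q <> id.
  move=> q1 qid; apply: q1; rewrite -[q]quot_piK; apply/quot_piP.
  by rewrite coset_rel_sym /coset_rel invg1 mul1g; apply/kernelP.
have perfX := minimal_no_isolated_points.
have proxQ : extremely_proximal act [pred q : Q | true].
  move=> U V oU U0 oV V0.
  have [g _ gV] := convergence_extremely_proximal oU U0 oV V0.
  by exists (quot_pi _ g) => //; rewrite actE.
move=> N snN [q qN q1]; split.
  by exists (Sub q qN) => /(congr1 val).
have [x qx] : exists x, act q x <> x.
  apply: contrapT => nqx; apply: (act_faithful q q1); apply/funext => x.
  by apply: contrapT => qx; apply: nqx; exists x.
have proxN : extremely_proximal act N.
  apply: (extremely_proximal_subnormal hausdorffX perfX act1 actM act_cont) => //.
  by exists q => //; exists x.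
move=> F finF F1 n _.
apply: (powers_partition hausdorffX perfX actM act_cont x n proxN finF).
move=> f Ff; apply: convergence_topologically_free; apply: act_faithful => vf1.
by apply: (F1 f Ff); apply: val_inj.
Qed.

End ConvergenceActionTheory.

Theorem corollary1p3 (R : realType) (G : groupType) (X : metricType R)
    (rho : G -> X -> X) (countableG : countable [set: G])
    (compactX : compact [set: X]) (convergence_rho : convergence_action rho)
    (minimal_rho : minimal_action rho)
    (non_elementary_rho : non_elementary rho) :
  exists Ra : normalClosed G,
    [/\ is_amenable_radical R Ra,
        finite_set [set` Ra],
        [set` Ra] = action_kernel rho
      & strongly_powers_group (quotient_group Ra)].
Proof.
have [actX _ _] := convergence_rho; exists (kernel actX).
have finK : finite_set [set` kernel actX] by exact: kernel_finite.
split=> //.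
(* The kernel is amenable because it is finite; finiteness passes to its subtype along the injection
   [val]. *)
- split; last exact: amenable_normal_sub_kernel.
  apply/finite_amenable/(sub_finite_set (B := val @^-1` [set` kernel actX])).
    by move=> g _; exact: valP.
  by apply: finite_preimage => // g h _ _; exact: val_inj.
- apply/seteqP.
  by split=> g; [exact: (kernelP actX g).1 | exact: (kernelP actX g).2].
- exact: quotient_kernel_strongly_powers.
Qed.
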